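(* Let $A$ be a real $3\times 3$ symmetric matrix that is not of maximal trace over rotation matrices. Let $\sigma$ be the largest eigenvalue of $A$, and let $w$ be a unit vector in $\mathbb{R}^3$ that is an eigenvector of $A$ corresponding to $\sigma$. Let $W=2ww^T-I$, where $I$ is the $3\times 3$ identity matrix. Then $WA$ is of maximal trace over rotation matrices.
   Context: A rotation matrix is a real orthogonal matrix of determinant one. A real $d\times d$ matrix $M$ is said to be of maximal trace over rotation matrices if $\mathrm{tr}(M)\geq \mathrm{tr}(UM)$ for every $d\times d$ rotation matrix $U$. Vectors are column vectors. *)

(* Defs.v *)
From HB Require Import structures.
From mathcomp Require Import all_boot all_order all_algebra.
From mathcomp Require Import reals.

Set Implicit Arguments.
Unset Strict Implicit.
Unset Printing Implicit Defensive.

Import Order.TTheory GRing.Theory Num.Theory.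
Local Open Scope ring_scope.

Definition rotation (R : realType) (n : nat) (U : 'M[R]_n) : Prop :=
  U^T *m U = 1%:M /\ \det U = 1.

Definition max_trace (R : realType) (n : nat) (M : 'M[R]_n) : Prop :=
  forall U : 'M[R]_n, rotation U -> \tr (U *m M) <= \tr M.

(* [eigenvalue] refers to row vectors ([v *m A = a *: v]); a square matrix has
   the same eigenvalues acting on columns. *)
Definition largest_eigenvalue (R : realType) (n : nat) (A : 'M[R]_n) (s : R)
  : Prop :=
  eigenvalue A s /\ forall a : R, eigenvalue A a -> a <= s.

(* The library's norm [`|v|] on matrices is the sup norm, not this one. *)
Definition norm2 (R : realType) (n : nat) (v : 'cV[R]_n) : R :=
  Num.sqrt (\sum_i v i ord0 ^+ 2).

(* Main.v *)
Require Import Defs.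
From HB Require Import structures.
From mathcomp Require Import all_boot all_order all_algebra.
From mathcomp Require Import reals.
From mathcomp Require Import ring lra.

Set Implicit Arguments.
Unset Strict Implicit.
Unset Printing Implicit Defensive.

Import Order.TTheory GRing.Theory Num.Theory.
Local Open Scope ring_scope.

(** Write T(M) = tr(M) I - M.  For a symmetric M of order three, M is of maximal
    trace over rotation matrices as soon as T(M) is positive semidefinite
    ([max_trace_of_psd]): a rotation about a unit axis u through the angle
    theta satisfies
      tr M - tr (U M) = (1 - cos theta) (u^T T(M) u).
    The axis is never extracted.  The symmetric matrix
    K = U + U^T - (tr U - 1) I equals 2 (1 - cos theta) u u^T, and all that is
    used of it is K^2 = (tr K) K, a form of the Cayley-Hamilton identity.

    Let sigma >= b >= c be the eigenvalues of A.  Those of T(A) are b + c,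
    sigma + c and sigma + b, so if b + c >= 0 then T(A) is positive
    semidefinite and A is of maximal trace; by hypothesis, then, b + c < 0.
    The matrix W A has eigenvalues sigma, -b and -c, so T(W A) has eigenvalues
    -(b + c), sigma - c and sigma - b, all nonnegative, and
    [max_trace_of_psd] applies to W A.

    The eigenvalues b and c are not computed either.  Put N = sigma I - A,
    P = w w^T and E = I - P.  Since N kills w, it lives on the plane
    orthogonal to w, where it satisfies its quadratic characteristic equation
    N^2 = t N - d E with t = tr N and d = tr (adj N) ([kernel_quadratic]).
    Its two roots are real since N is symmetric, and nonnegative since sigma is
    the largest eigenvalue; hence t >= 0 and d >= 0
    ([kernel_invariants_ge0]).  These signs and the quadratic equation force
    positive semidefiniteness ([psd_quadratic]).  The same lemma applies to
    t E - N, which satisfies the same equation because passing from N to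
    t E - N swaps the two roots.  The theorem follows from the decompositions
      T(A)   = N + (b + c) I,
      T(W A) = (t E - N) - (b + c) P,
    where b + c = tr A - sigma. *)

(** * Invariants of a matrix of order three *)

(** Indexing the entries by natural numbers lets the ordinals produced by
    cofactor expansions be compared by computation. *)
Lemma matrix_natE (R : Type) (m n : nat) (X : 'M[R]_(m.+1, n.+1)) :
  exists f : nat -> nat -> R, X = \matrix_(i, j) f i j.
Proof.
exists (fun i j => X (inord i) (inord j)).
by apply/matrixP => i j; rewrite !mxE !inord_val.
Qed.

Lemma det2 (R : comNzRingType) (X : 'M[R]_2) :
  \det X = X ord0 ord0 * X ord_max ord_max - X ord0 ord_max * X ord_max ord0.
Proof.
have [f ->] := matrix_natE X.
rewrite (expand_det_row _ ord0) !big_ord_recl big_ord0 /cofactor !det_mx11.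
by rewrite !mxE /= /bump /=; ring.
Qed.

(** The Cayley-Hamilton identity divided by X: the trace of the adjugate is the
    middle coefficient of the characteristic polynomial. *)
Lemma adjugate3 (R : comNzRingType) (X : 'M[R]_3) :
  \adj X = X *m X - \tr X *: X + (\tr (\adj X))%:M.
Proof.
have [f ->] := matrix_natE X.
apply/matrixP => -[[|[|[|//]]] ?] -[[|[|[|//]]] ?].
all: rewrite !mxE /mxtrace !big_ord_recl !big_ord0 !mxE /cofactor.
all: by rewrite !det2 !mxE /= /bump /= ?addn0 ?add0n ?add1n; ring.
Qed.

Lemma det_sub_scalar3 (R : comNzRingType) (X : 'M[R]_3) (x : R) :
  \det (X - x%:M) =
  \det X - \tr (\adj X) * x + \tr X * x ^+ 2 - x ^+ 3.
Proof.
have [f ->] := matrix_natE X.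
rewrite !(expand_det_row _ ord0) /mxtrace !big_ord_recl !big_ord0 !mxE.
by rewrite /cofactor !det2 !mxE /= /bump /=; ring.
Qed.

(** * Positive semidefinite matrices *)

(** With a matrix Z of any width in place of a vector, the condition amounts to
    the usual one, since the trace adds up the values of the quadratic form at
    the columns of Z.  This form lets traces be bounded with no passage to
    entries. *)
Definition psd (R : realFieldType) (n : nat) (X : 'M[R]_n) : Prop :=
  forall (p : nat) (Z : 'M[R]_(n, p)), 0 <= \tr (Z^T *m X *m Z).

Section Gram.
Variables (R : realFieldType) (m n : nat).
Implicit Types Z : 'M[R]_(m, n).

Lemma trace_gram Z : \tr (Z^T *m Z) = \sum_i \sum_j Z j i ^+ 2.
Proof.
by apply: eq_bigr => i _; rewrite mxE; apply: eq_bigr => j _; rewrite mxE.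
Qed.

Lemma trace_gram_ge0 Z : 0 <= \tr (Z^T *m Z).
Proof.
by rewrite trace_gram; do 2!apply: sumr_ge0 => ? _; apply: sqr_ge0.
Qed.

Lemma trace_gram_eq0 Z : \tr (Z^T *m Z) = 0 -> Z = 0.
Proof.
rewrite trace_gram => /eqP.
rewrite psumr_eq0 => [/allP Z0|i _]; last first.
  by apply: sumr_ge0 => ? _; apply: sqr_ge0.
apply/matrixP => j i; rewrite mxE.
have := Z0 i (mem_index_enum _).
rewrite psumr_eq0 => [/allP/(_ j (mem_index_enum _))|? _]; last exact: sqr_ge0.
by rewrite sqrf_eq0 => /eqP.
Qed.

End Gram.

Section Psd.
Variables (R : realFieldType) (n : nat).
Implicit Types X Y E : 'M[R]_n.

Lemma psdD X Y : psd X -> psd Y -> psd (X + Y).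
Proof.
by move=> pX pY p Z; rewrite mulmxDr mulmxDl mxtraceD addr_ge0.
Qed.

Lemma psdZ (a : R) X : 0 <= a -> psd X -> psd (a *: X).
Proof.
by move=> a0 pX p Z; rewrite -scalemxAr -scalemxAl mxtraceZ mulr_ge0.
Qed.

Lemma psd_gram (m : nat) (V : 'M[R]_(m, n)) : psd (V^T *m V).
Proof.
move=> p Z; have := trace_gram_ge0 (V *m Z).
by rewrite trmx_mul !mulmxA.
Qed.

(** If t > 0, dividing X^2 + d E = t X by t writes X as a combination, with
    nonnegative coefficients, of the positive semidefinite matrices X^2 = X^T X
    and E = E^T E.  If t = 0, then X^2 = - d E has a nonpositive trace, which
    for a symmetric X means X = 0. *)
Lemma psd_quadratic X E (t d : R) :
  X^T = X -> E^T = E -> E *m E = E -> 0 <= t -> 0 <= d ->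
  X *m X = t *: X - d *: E -> psd X.
Proof.
move=> symX symE idE t_ge0 d_ge0 XX.
have psdXX : psd (X *m X) by rewrite -{1}symX; apply: psd_gram.
have psdE : psd E by rewrite -idE -{1}symE; apply: psd_gram.
have [t0|t_neq0] := eqVneq t 0.
  suff -> : X = 0 by move=> p Z; rewrite mulmx0 mul0mx mxtrace0.
  apply: trace_gram_eq0; apply/eqP; rewrite eq_le trace_gram_ge0 andbT.
  rewrite symX XX t0 scale0r sub0r raddfN /= mxtraceZ oppr_le0 mulr_ge0 //.
  by have := psdE n 1%:M; rewrite trmx1 mul1mx mulmx1.
have -> : X = t^-1 *: (X *m X + d *: E).
  by rewrite XX subrK scalerA mulVf // scale1r.
by apply: psdZ; [rewrite invr_ge0 | apply: psdD => //; apply: psdZ].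
Qed.

End Psd.

(** * Rotations of three-space *)

(** For a rotation through theta about the unit vector u, K is
    2 (1 - cos theta) u u^T and its trace is 3 - tr U.  The identity comes from
    Cayley-Hamilton: the adjugate of U is its inverse U^T, so [adjugate3] and
    its transpose express U^2 and (U^T)^2 linearly in U, U^T and I. *)
Lemma rotation_axis_sqr (R : realType) (U : 'M[R]_3) :
  rotation U ->
  let K := U + U^T - (\tr U - 1)%:M in K *m K = (3%:R - \tr U) *: K.
Proof.
move=> [UtU detU] K.
have UUt : U *m U^T = 1%:M by apply: mulmx1C.
have adjU : \adj U = U^T.
  by rewrite -[LHS]mul1mx -UtU -mulmxA mul_mx_adj detU mulmx1.
have CH := adjugate3 U; rewrite adjU mxtrace_tr in CH.
have UU : U *m U = \tr U *: U - (\tr U)%:M + U^T.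
  by rewrite CH; apply/matrixP => i j; rewrite !mxE; ring.
have VV : U^T *m U^T = \tr U *: U^T - (\tr U)%:M + U.
  by rewrite -trmx_mul UU !linearD /= linearN linearZ /= tr_scalar_mx trmxK.
have -> : K *m K = U *m U + U *m U^T + (U^T *m U + U^T *m U^T)
    - (2%:R * (\tr U - 1)) *: (U + U^T) + ((\tr U - 1) ^+ 2)%:M.
  rewrite /K mulmxBl !mulmxBr !mulmxDl !mulmxDr !mul_scalar_mx !mul_mx_scalar.
  rewrite scale_scalar_mx.
  by apply/matrixP => i j; rewrite !mxE; ring.
rewrite UU VV UtU UUt /K.
by apply/matrixP => i j; rewrite !mxE; ring.
Qed.

(** Because M is symmetric, tr (U M) only depends on U + U^T, and
    2 (tr M - tr (U M)) = tr (K T) with K as in [rotation_axis_sqr] and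
    T = tr(M) I - M.  From K^2 = (tr K) K follows
    (tr K) tr (K T) = tr (K T K) >= 0.  Here tr K = 3 - tr U is half the sum of
    the squares of the entries of I - U, so it is positive unless U = I. *)
Lemma max_trace_of_psd (R : realType) (M : 'M[R]_3) :
  M^T = M -> psd ((\tr M)%:M - M) -> max_trace M.
Proof.
move=> symM psdT U rotU; set T := _ - _ in psdT.
have [UtU _] := rotU.
have := rotation_axis_sqr rotU; set K := _ - _ => /= KK.
have symK : K^T = K.
  by rewrite /K !linearD /= linearN /= tr_scalar_mx trmxK [U^T + _]addrC.
have trK : \tr K = 3%:R - \tr U.
  by rewrite /K !mxtraceD raddfN /= mxtrace_scalar mxtrace_tr; ring.
have trUtM : \tr (U^T *m M) = \tr (U *m M).
  by rewrite -mxtrace_tr trmx_mul trmxK symM mxtrace_mulC.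
have gap : 2%:R * (\tr M - \tr (U *m M)) = \tr (K *m T).
  rewrite /T mulmxBr raddfB /= mul_mx_scalar mxtraceZ trK /K.
  rewrite mulmxBl mulmxDl mul_scalar_mx raddfB /= mxtraceD mxtraceZ trUtM.
  by ring.
have trK_gap : 0 <= \tr K * \tr (K *m T).
  rewrite -mxtraceZ scalemxAl trK -KK -mulmxA mxtrace_mulC.
  by rewrite -{1}symK; apply: psdT.
have gramB : \tr ((1%:M - U)^T *m (1%:M - U)) = 2%:R * \tr K.
  rewrite [(_ - U)^T]linearB /= trmx1 mulmxBr mulmx1 mulmxBl mul1mx UtU trK.
  by rewrite !raddfB /= mxtrace_tr mxtrace1; ring.
have trK_ge0 : 0 <= \tr K by have := trace_gram_ge0 (1%:M - U); lra.
have [trK0|trK_neq0] := eqVneq (\tr K) 0.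
  have /eqP : 1%:M - U = 0.
    by apply: trace_gram_eq0; rewrite gramB trK0 mulr0.
  by rewrite subr_eq0 => /eqP <-; rewrite mul1mx.
rewrite -subr_ge0 -(pmulr_rge0 _ (ltr0Sn R 1)) gap.
by rewrite -(pmulr_rge0 _ (_ : 0 < \tr K)) // lt_def trK_neq0.
Qed.

(** * Symmetric matrices with a known kernel vector *)

Section KernelVector.
Variables (R : rcfType) (N : 'M[R]_3) (w : 'cV[R]_3).
Hypotheses (symN : N^T = N) (Nw : N *m w = 0) (ww : w^T *m w = 1%:M).

Local Notation P := (w *m w^T).
Local Notation E := (1%:M - P).
Local Notation t := (\tr N).
Local Notation d := (\tr (\adj N)).

Let symP : P^T = P.
Proof. by rewrite trmx_mul trmxK. Qed.

Let PP : P *m P = P.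
Proof. by rewrite mulmxA -[w *m w^T *m w]mulmxA ww mulmx1. Qed.

Let NP : N *m P = 0.
Proof. by rewrite mulmxA Nw mul0mx. Qed.

Let PN : P *m N = 0.
Proof. by rewrite -symP -symN -trmx_mul NP trmx0. Qed.

Let trP : \tr P = 1.
Proof. by rewrite mxtrace_mulC ww mxtrace1. Qed.

Lemma sym_compl : E^T = E.
Proof. by rewrite linearB /= trmx1 symP. Qed.

Lemma idem_compl : E *m E = E.
Proof. by rewrite mulmxBl mul1mx mulmxBr mulmx1 PP subrr subr0. Qed.

Lemma kernel_compl : N *m E = N /\ E *m N = N.
Proof. by rewrite mulmxBl mulmxBr mulmx1 mul1mx NP PN subr0. Qed.

Lemma det_kernel : \det N = 0.
Proof.
apply/eqP/det0P; exists w^T.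
  apply: contra_eq_neq ww => ->; rewrite mul0mx eq_sym.
  by apply/eqP => /matrixP/(_ 0 0); rewrite !mxE => /eqP; rewrite oner_eq0.
by rewrite -{1}symN -trmx_mul Nw trmx0.
Qed.

(** F = adj N = N^2 - t N + d I acts as d on w.  As N F = (det N) I = 0,
    multiplying that formula for F by F gives F^2 = d F.  Hence
    G = F - d P satisfies G^2 = d G, with tr G = d - d = 0, so that
    tr (G^T G) = 0 and G = 0. *)
Lemma adjugate_kernel : \adj N = d *: P.
Proof.
set F := \adj N.
have FE : F = N *m N - t *: N + d%:M := adjugate3 N.
have symF : F^T = F by rewrite /F trmx_adj symN.
have FP : F *m P = d *: P.
  rewrite FE mulmxDl mulmxBl -mulmxA NP mulmx0 -scalemxAl NP scaler0.
  by rewrite subr0 add0r mul_scalar_mx.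
have PF : P *m F = d *: P.
  by rewrite -symP -symF -trmx_mul FP linearZ /= symP.
have NF : N *m F = 0 by rewrite mul_mx_adj det_kernel raddf0.
have FF : F *m F = d *: F.
  rewrite {1}FE mulmxDl mulmxBl -mulmxA NF mulmx0 -scalemxAl NF scaler0.
  by rewrite subr0 add0r mul_scalar_mx.
apply/eqP; rewrite -subr_eq0; apply/eqP/trace_gram_eq0.
have -> : (F - d *: P)^T = F - d *: P by rewrite linearB linearZ /= symF symP.
have -> : (F - d *: P) *m (F - d *: P) = d *: (F - d *: P).
  rewrite mulmxBl !mulmxBr -!scalemxAr -!scalemxAl FF FP PF PP scalerBr.
  by apply/matrixP => i j; rewrite !mxE; ring.
by rewrite mxtraceZ raddfB /= mxtraceZ trP mulr1 subrr mulr0.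
Qed.

Lemma kernel_quadratic : N *m N = t *: N - d *: E.
Proof.
have := adjugate3 N; rewrite adjugate_kernel mxtraceZ trP mulr1 => FE.
move/esym/(canRL (addrK _))/(canRL (subrK _)): FE => ->.
by apply/matrixP => i j; rewrite !mxE; ring.
Qed.

(** K is twice the traceless part of N on the plane orthogonal to w.  Its
    square is the discriminant times E, and K^2 = K^T K has a nonnegative
    trace: this is why a symmetric matrix has real eigenvalues in the plane. *)
Lemma kernel_discr_ge0 : 0 <= t ^+ 2 - 4%:R * d.
Proof.
have [NE EN] := kernel_compl.
pose K := 2%:R *: N - t *: E.
have symK : K^T = K by rewrite /K linearB !linearZ /= symN sym_compl.
have KK : K *m K = (t ^+ 2 - 4%:R * d) *: E.
  rewrite /K mulmxBl !mulmxBr -!scalemxAr -!scalemxAl NE EN idem_compl.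
  by rewrite kernel_quadratic; apply/matrixP => i j; rewrite !mxE; ring.
have trE : \tr E = 2%:R by rewrite raddfB /= mxtrace1 trP; ring.
by have := trace_gram_ge0 K; rewrite symK KK mxtraceZ trE pmulr_lge0 ?ltr0Sn.
Qed.

Hypothesis eig_ge0 : forall r, \det (N - r%:M) = 0 -> 0 <= r.

(** The smaller root r = (t - sqrt D) / 2 of x^2 - t x + d, where D is the
    discriminant t^2 - 4 d, is an eigenvalue of N.  So r >= 0, that is,
    sqrt D <= t; squaring gives d >= 0. *)
Lemma kernel_invariants_ge0 : 0 <= t /\ 0 <= d.
Proof.
have D_ge0 := kernel_discr_ge0; set D := _ - _ in D_ge0.
have sq := sqr_sqrtr D_ge0.
have s_ge0 : 0 <= Num.sqrt D := sqrtr_ge0 D.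
have r_ge0 : 0 <= (t - Num.sqrt D) / 2%:R.
  apply: eig_ge0; rewrite det_sub_scalar3 det_kernel.
  rewrite /D in sq *.
  set s := Num.sqrt _ in sq *.
  have -> : d = (t ^+ 2 - s ^+ 2) / 4%:R by rewrite sq; field.
  by field.
have st : Num.sqrt D <= t by lra.
have t_ge0 : 0 <= t := le_trans s_ge0 st.
split=> //.
have : Num.sqrt D ^+ 2 <= t ^+ 2 by rewrite lerXn2r ?nnegrE.
by rewrite sq /D; lra.
Qed.

Lemma kernel_psd : psd N.
Proof.
have [t_ge0 d_ge0] := kernel_invariants_ge0.
exact: (psd_quadratic symN sym_compl idem_compl t_ge0 d_ge0 kernel_quadratic).
Qed.

Lemma kernel_reflected_psd : psd (t *: E - N).
Proof.
have [t_ge0 d_ge0] := kernel_invariants_ge0.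
have [NE EN] := kernel_compl.
apply: (psd_quadratic _ sym_compl idem_compl t_ge0 d_ge0).
  by rewrite linearB linearZ /= symN sym_compl.
rewrite mulmxBl !mulmxBr -!scalemxAr -!scalemxAl NE EN idem_compl.
by rewrite kernel_quadratic; apply/matrixP => i j; rewrite !mxE; ring.
Qed.

End KernelVector.

(** * The half-turn about a top eigenvector *)

Lemma norm2_gram (R : realType) (n : nat) (v : 'cV[R]_n) :
  norm2 v = 1 -> v^T *m v = 1%:M.
Proof.
move=> v1; rewrite [LHS]mx11_scalar mxE.
suff -> : \sum_j v^T 0 j * v j 0 = 1 by [].
have <- : \sum_i v i 0 ^+ 2 = 1.
  rewrite -[RHS](expr1n _ 2) -v1 sqr_sqrtr //.
  by apply: sumr_ge0 => i _; apply: sqr_ge0.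
by apply: eq_bigr => i _; rewrite mxE.
Qed.

Lemma eigenvalue_det (F : fieldType) (n : nat) (A : 'M[F]_n) (a : F) :
  \det (A - a%:M) = 0 -> eigenvalue A a.
Proof.
move=> /eqP/det0P[v v_neq0 /eqP]; rewrite mulmxBr mul_mx_scalar subr_eq0.
by move=> /eqP vA; apply/eigenvalueP; exists v.
Qed.

Theorem proposition11 (R : realType) (A : 'M[R]_3) (sigma : R) (w : 'cV[R]_3)
  (symA : A^T = A)
  (notmaxA : ~ max_trace A)
  (sigma_max : largest_eigenvalue A sigma)
  (w_unit : norm2 w = 1)
  (w_eigen : A *m w = sigma *: w) :
  let W : 'M[R]_3 := 2%:R *: (w *m w^T) - 1%:M in
  max_trace (W *m A).
Proof.
move=> W.
have ww := norm2_gram w_unit.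
pose N := sigma%:M - A.
have symN : N^T = N by rewrite linearB /= tr_scalar_mx symA.
have Nw : N *m w = 0 by rewrite mulmxBl mul_scalar_mx w_eigen subrr.
have eigN r : \det (N - r%:M) = 0 -> 0 <= r.
  move=> detN.
  suff /sigma_max.2 : eigenvalue A (sigma - r) by lra.
  apply: eigenvalue_det.
  have -> : A - (sigma - r)%:M = -1 *: (N - r%:M).
    by apply/matrixP => i j; rewrite !mxE; ring.
  by rewrite detZ detN mulr0.
have psd1 : psd (1%:M : 'M[R]_3).
  by rewrite -[1%:M]mulmx1 -{1}trmx1; apply: psd_gram.
have trN : \tr N = 3%:R * sigma - \tr A.
  by rewrite raddfB /= mxtrace_scalar; ring.
have trA_lt : \tr A < sigma.
  rewrite ltNge; apply/negP => trA_ge; apply: notmaxA.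
  apply: max_trace_of_psd => //.
  have -> : (\tr A)%:M - A = N + (\tr A - sigma) *: 1%:M.
    by apply/matrixP => i j; rewrite !mxE; ring.
  apply: psdD; first exact: (kernel_psd symN Nw ww eigN).
  by apply: psdZ => //; lra.
have wA : w^T *m A = sigma *: w^T by rewrite -symA -trmx_mul w_eigen linearZ.
have WA : W *m A = (2%:R * sigma) *: (w *m w^T) - A.
  by rewrite mulmxBl mul1mx -scalemxAl -mulmxA wA -scalemxAr scalerA.
have trWA : \tr (W *m A) = \tr N - sigma.
  by rewrite WA raddfB /= mxtraceZ mxtrace_mulC ww mxtrace1 trN; ring.
apply: max_trace_of_psd.
  by rewrite WA linearB linearZ /= symA trmx_mul trmxK.
rewrite trWA WA.
have -> : (\tr N - sigma)%:M - ((2%:R * sigma) *: (w *m w^T) - A) =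
    (\tr N *: (1%:M - w *m w^T) - N)
    + (\tr N - 2%:R * sigma) *: (w^T^T *m w^T).
  rewrite trmxK; move: (w *m w^T) (\tr N) => P t.
  by apply/matrixP => i j; rewrite !mxE; ring.
apply: psdD; first exact: (kernel_reflected_psd symN Nw ww eigN).
by apply: psdZ; [lra | apply: psd_gram].
Qed.
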